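(* The set of $f$-vectors of independence complexes of chordal graphs is equal to the set of $h$-vectors (up to trailing zeros) of balanced, vertex decomposable independence complexes of chordal graphs.
   Context: Graphs are finite and simple. A graph is chordal if it has no induced cycle of length $\ge4$ (every cycle of length $\geq 4$ has a chord). The independence complex ${\rm Ind}(G)$ of a graph $G$ with vertex set $V_G$ is the simplicial complex of all independent sets of $G$, i.e. all $W\subseteq V_G$ containing no edge of $G$. A simplicial complex $\Delta$ on a finite set $V$ is a collection of subsets (faces) of $V$ closed under taking subsets and containing $\emptyset$; facets are the inclusion-maximal faces. A face $\sigma$ has dimension $|\sigma|-1$; $\dim\Delta$ is the maximum dimension of a facet; $\Delta$ is pure if all facets have the same dimension; a simplex is a complex with exactly one facet (including $\{\emptyset\}$). If $\dim\Delta=d$, then $f(\Delta)=(f_{-1},f_0,\dots,f_d)$ with $f_i$ the number of faces of dimension $i$, and $h(\Delta)=(h_0,\dots,h_{d+1})$ with $h_k=\sum_{i=0}^k(-1)^{k-i}\binom{d+1-i}{k-i}f_{i-1}$. Trailing zeros of $h$-vectors are ignored when comparing with $f$-vectors. An $s$-colouring of $\Delta$ is a partition $V=V_1\cup\dots\cup V_s$ into pairwise disjoint, possibly empty sets with $|F\cap V_j|\le1$ for every facet $F$ and every $j$. A complex of dimension $d-1$ is balanced if it has a $d$-colouring. For a vertex $v$ with $\{v\}\in\Delta$: $\Delta\setminus v=\{\tau\in\Delta : v\notin\tau\}$ and ${\rm link}_\Delta(v)=\{\tau\in\Delta : v\notin\tau,\ \tau\cup\{v\}\in\Delta\}$. A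 pure complex is vertex decomposable if it is a simplex, or it has a vertex $v$ such that $\Delta\setminus v$ and ${\rm link}_\Delta(v)$ are both (pure and) vertex decomposable. (Vertex decomposable complexes are always assumed pure.) *)

(* Defs.v *)
From mathcomp Require Import all_boot all_order all_algebra.

Set Implicit Arguments.
Unset Strict Implicit.
Unset Printing Implicit Defensive.

Import GRing.Theory.
Local Open Scope ring_scope.

(* The vertex type may be empty: the graph without vertices is needed to
   realise the f-vector (1) of the complex {set0}. *)
Record sgraph := SGraph {
  vertex :> finType;
  edge : rel vertex;
  edge_sym : symmetric edge;
  edge_irrefl : irreflexive edge
}.
Arguments edge {G} : rename.

(* A cycle is the duplicate-free sequence of its vertices; a chord is an edge
   between two of them that are not cyclically consecutive. *)
Definition chordal (G : sgraph) : Prop :=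
  forall c : seq G, ucycle edge c -> (4 <= size c)%N ->
  exists x y : G,
    [/\ x \in c, y \in c, edge x y, y != next c x & x != next c y].

Section Complexes.
Variable V : finType.
Implicit Types (D : {set {set V}}) (v : V).

(* The definitions below are meant for families D satisfying [is_complex];
   [Ind], [deletion] and [link] produce such families (lemmas below). *)
Definition is_complex D : Prop :=
  set0 \in D /\ forall A B : {set V}, A \subset B -> B \in D -> A \in D.

Definition facets D : {set {set V}} := [set F | maxset (mem D) F].

(* rank D = dim D + 1, which avoids the dimension -1 of {set0}. *)
Definition rank D : nat := (\max_(F in facets D) #|F|)%N.

Definition pure D : Prop := {in facets D &, forall F1 F2 : {set V}, #|F1| = #|F2|}.

Definition simplex D : Prop := #|facets D| = 1%N.

(* faces_of_size D i is f_{i-1}. *)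
Definition faces_of_size D (i : nat) : nat := #|[set F in D | #|F| == i]|.

Definition fvector D : seq int :=
  mkseq (fun i => (faces_of_size D i)%:Z) (rank D).+1.

Definition hvector D : seq int :=
  mkseq (fun k => \sum_(i < k.+1)
           (-1) ^+ (k - i) * 'C(rank D - i, k - i)%:Z * (faces_of_size D i)%:Z)
        (rank D).+1.

(* A partition of V into s labelled, possibly empty, classes is given by the
   function sending each vertex to the label of its class. *)
Definition is_colouring D (s : nat) (col : V -> 'I_s) : Prop :=
  forall F, F \in facets D ->
  forall j, (#|F :&: [set x | col x == j]| <= 1)%N.

Definition balanced D : Prop :=
  exists col : V -> 'I_(rank D), is_colouring D col.

Definition deletion D v : {set {set V}} := [set F in D | v \notin F].

Definition link D v : {set {set V}} :=
  [set F in D | (v \notin F) && (v |: F \in D)].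

Inductive vertex_decomposable : {set {set V}} -> Prop :=
| VD_simplex D : pure D -> simplex D -> vertex_decomposable D
| VD_vertex D v : pure D -> [set v] \in D ->
    vertex_decomposable (deletion D v) -> vertex_decomposable (link D v) ->
    vertex_decomposable D.

Lemma deletion_complex D v : is_complex D -> is_complex (deletion D v).
Proof.
move=> [D0 Dsub]; split=> [|A B sAB]; rewrite !inE ?D0 //.
case/andP=> DB vB; rewrite (Dsub A B) //=.
by apply: contra vB; apply: (subsetP sAB).
Qed.

Lemma link_complex D v :
  is_complex D -> [set v] \in D -> is_complex (link D v).
Proof.
move=> [D0 Dsub] Dv; split=> [|A B sAB]; rewrite !inE ?D0 ?setU0 //.
case/and3P=> DB vB DvB; rewrite (Dsub A B) //= (Dsub _ _ (setUS _ sAB)) // andbT.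
by apply: contra vB; apply: (subsetP sAB).
Qed.

End Complexes.

Definition Ind (G : sgraph) : {set {set G}} :=
  [set W : {set G} | [forall x in W, forall y in W, ~~ edge x y]].

Lemma Ind_complex (G : sgraph) : is_complex (Ind G).
Proof.
split=> [|A B /subsetP sAB].
  by rewrite inE; apply/forall_inP => x; rewrite inE.
rewrite !inE => /forall_inP indB.
apply/forall_inP => x /sAB /indB /forall_inP indBx.
by apply/forall_inP => y /sAB /indBx.
Qed.

(* The coefficient sequence of Poly s is s with its trailing zeros removed. *)
Definition trim_zeros (s : seq int) : seq int := polyseq (Poly s).

(* Main.v *)
Require Import Defs.
From mathcomp Require Import all_boot all_order all_algebra.
From mathcomp Require Import zify ring.

Set Implicit Arguments.
Unset Strict Implicit.
Unset Printing Implicit Defensive.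

Import GRing.Theory.

(* Call G a clique-whiskering when its vertices are partitioned into d cliques, each containing
   a vertex w_j with no neighbour outside its clique.  Every independent set of G arises uniquely
   from an independent set W avoiding the w_j by adding some of the w_j whose cliques W misses, so
   Ind G is pure of rank d, the f-vector of Ind G is a binomial transform of that of
   Ind (G - {w_j}), and undoing this transform gives h(Ind G) = f(Ind (G - {w_j})).

   From f to h: attach a pendant vertex to each vertex of a chordal graph.
   From h to f: if Ind G is balanced and pure, the colour classes are cliques met by every facet.
   In a chordal graph each component C of G - K, for a clique K, has a vertex adjacent to every
   vertex of K that has a neighbour in C; these vertices form an independent set dominating all of
   K that is adjacent to something outside.  Hence a colour class K without a vertex w having
   N(w) contained in K would be missed by some facet, and G is a clique-whiskering. *)

(** * Binomial identities and inversion *)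

Lemma mul_bin_bin n m l : l <= m <= n ->
  'C(n, m) * 'C(m, l) = 'C(n, l) * 'C(n - l, m - l).
Proof.
case/andP=> lm mn; have ln := leq_trans lm mn.
have pos : 0 < (n - m)`! * (l`! * (m - l)`!) by rewrite !muln_gt0 !fact_gt0.
apply/eqP; rewrite -(eqn_pmul2r pos); apply/eqP.
have H1 := bin_fact lm; have H2 := bin_fact mn; have H3 := bin_fact ln.
have := bin_fact (leq_sub2r l mn); have -> : n - l - (m - l) = n - m by lia.
move=> H4; transitivity n`!; first by rewrite -H2 -H1; ring.
by rewrite -H3 -H4; ring.
Qed.

(** After exchanging the sums, the coefficient of [a j] is ['C(d - j, k - j)] times the expansion of
    (-1 + 1)^(k - j), which vanishes unless j = k. *)
Lemma binomial_inversion (d : nat) (a f : nat -> nat) :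
  (forall i, i <= d -> f i = \sum_(j < i.+1) a j * 'C(d - j, i - j)) ->
  forall k, k <= d ->
  (\sum_(i < k.+1) (-1) ^+ (k - i) * 'C(d - i, k - i)%:Z * (f i)%:Z = (a k)%:Z)%R.
Proof.
move=> fE k kd.
pose T i j : int := ((-1) ^+ (k - i) * ('C(d - i, k - i) * (a j * 'C(d - j, i - j)))%:Z)%R.
transitivity (\sum_(i < k.+1) \sum_(j < k.+1 | (j <= i)%N) T i j)%R.
  apply: eq_bigr => -[i /= ik] _; rewrite fE; last exact: leq_trans kd.
  transitivity (\sum_(j < i.+1) T i j)%R; last exact: big_ord_widen.
  rewrite -mulrA -PoszM big_distrr /= (big_morph Posz PoszD (erefl _)).
  by rewrite mulr_sumr.
rewrite (exchange_big_dep predT) //= big_ord_recr /=.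
rewrite big1 ?add0r => [|[j /= jk] _].
  rewrite (bigD1 ord_max) //= big1 => [|i /andP[ki]]; last first.
    by rewrite -val_eqE eqn_leq ki andbT -ltnS ltn_ord.
  by rewrite /T !subnn !bin0 muln1 mul1n expr0 mul1r addr0.
rewrite -(big_geq_mkord _ _ predT (T^~ j)) /= -{1}[j]add0n big_addn big_mkord.
rewrite subSn 1?ltnW //.
transitivity ((a j * 'C(d - j, k - j))%:Z * \sum_(i < (k - j).+1)
     (-1) ^+ (k - j - i) * 1 ^+ i *+ 'C(k - j, i))%R.
  rewrite mulr_sumr; apply: eq_bigr => -[i /= ik] _; rewrite /T expr1n mulr1.
  rewrite ltnS in ik.
  rewrite addnK [i + j]addnC !subnDA -mulr_natr natz mulrCA -PoszM; congr (_ * Posz _)%R.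
  rewrite -mulnA mul_bin_bin ?ik ?leq_sub2r //; lia.
by rewrite -exprDn addNr expr0n subn_eq0 leqNgt jk mulr0.
Qed.

(** * Sequences read as cycles and paths *)

Lemma mem_split (T : eqType) (c : seq T) x :
  x \in c -> exists a b, c = a ++ x :: b.
Proof. by case/splitPr=> a b; exists a, b. Qed.

Lemma next_cat_cons (T : eqType) (a c : seq T) (u v : T) :
  uniq (a ++ u :: v :: c) -> next (a ++ u :: v :: c) u = v.
Proof.
move=> Uc; rewrite next_nth mem_cat mem_head orbT.
have idx : index u (a ++ u :: v :: c) = size a.
  rewrite index_cat /= eqxx addn0 ifN //.
  by move: Uc; rewrite cat_uniq /= negb_or => /and3P[_ /andP[]].
case: a Uc idx => [|x a] Uc idx; first by rewrite idx.
by rewrite cat_cons in idx *; rewrite idx nth_cat /= ltnNge leqnSn /= subSnn.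
Qed.

Lemma next_last_cons (T : eqType) (u v : T) (b : seq T) :
  uniq (u :: rcons b v) -> next (u :: rcons b v) v = u.
Proof.
move=> Uc; rewrite next_nth inE mem_rcons mem_head orbT.
have idx : index v (u :: rcons b v) = (size b).+1.
  move: Uc; rewrite /= rcons_uniq mem_rcons inE negb_or.
  case/andP=> /andP[/negPf-> _] /andP[vb _].
  by rewrite -cats1 index_cat (negPf vb) /= eqxx addn0.
(* [next] wraps around through the default value of [nth], here the head [u]. *)
by rewrite idx nth_default // size_rcons.
Qed.

Lemma path_first (T : eqType) (e : rel T) (P : pred T) x p :
  path e x p -> P (last x p) ->
  exists q, [/\ path e x q, P (last x q), ~~ has P (belast x q) & subseq q p].
Proof.
elim: p x => [|a p IHp] x /=; first by exists [::].
case/andP=> exa /IHp h /h [q [pq lq nq sq]].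
case Px: (P x); first by exists [::].
by exists (a :: q); rewrite /= exa Px eqxx.
Qed.

(** * Chords of cycles, and the components left by deleting a clique *)

Section Chordal.
Variable G : sgraph.
Hypothesis chG : chordal G.

(** Listing the ends in cycle order turns non-consecutiveness into two nonempty arcs: [b] empty
    would make [v] the successor of [u], and [a ++ e] empty would make [u] the successor of [v]. *)
Lemma chord_split (c : seq G) : ucycle edge c -> 3 < size c ->
  exists a b e u v, [/\ c = a ++ u :: b ++ v :: e, edge u v, b != [::]
                      & a ++ e != [::]].
Proof.
move=> ucc /(chG ucc)[u [v [uc vc euv nvu nuv]]].
have [_ Uc] := andP ucc.
suff main (x y : G) a e : c = a ++ x :: e -> y \in e -> edge x y ->
    y != next c x -> x != next c y -> exists a b e u v,
    [/\ c = a ++ u :: b ++ v :: e, edge u v, b != [::] & a ++ e != [::]].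
  have [a [e def_c]] := mem_split uc.
  move: vc; rewrite {1}def_c mem_cat inE => /or3P[va|/eqP vu|ve].
  - have [a1 [a2 def_a]] := mem_split va.
    apply: (main v u a1 (a2 ++ u :: e)) => //.
    + by rewrite def_c def_a -catA.
    + by rewrite mem_cat mem_head orbT.
    + by rewrite edge_sym.
  - by rewrite vu edge_irrefl in euv.
  - exact: (main u v a e).
move=> def_c /mem_split[b [e' def_e]] exy nyx nxy.
rewrite def_e in def_c; exists a, b, e', x, y; split=> //.
  apply: contraNneq nyx => b0; rewrite def_c b0 next_cat_cons //.
  by rewrite def_c b0 in Uc.
apply: contraNneq nxy => /nilP; rewrite /nilp size_cat addn_eq0 => /andP[].
move=> /nilP a0 /nilP e0; have {}def_c : c = x :: rcons b y.
  by rewrite def_c a0 e0 -cats1.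
by rewrite def_c next_last_cons // -def_c.
Qed.

Lemma ucycle_arcs (a b e : seq G) (u v : G) : edge u v ->
  ucycle edge (a ++ u :: b ++ v :: e) ->
  ucycle edge (u :: rcons b v) /\ ucycle edge (a ++ u :: v :: e).
Proof.
move=> euv; rewrite -(rot_ucycle (size a)) rot_size_cat cat_cons -catA.
rewrite -(rot_ucycle (size a) _ (a ++ _)) rot_size_cat => /andP[/= cyc Ub].
rewrite rcons_cat cat_path /= in cyc; have /and3P[pb ev pe] := cyc.
split; apply/andP; split.
- by rewrite /= !rcons_path last_rcons pb ev edge_sym euv.
- have : uniq ((u :: rcons b v) ++ e ++ a) by rewrite /= cat_rcons.
  by rewrite cat_uniq => /andP[].
- by rewrite /= euv.
- apply: (@subseq_uniq _ _ (u :: b ++ v :: e ++ a)) Ub.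
  by rewrite /= eqxx suffix_subseq.
Qed.

(** Induction on the length: a chord cuts off a shorter cycle that still uses the edge between [y]
    and [x], until a triangle remains. *)
Lemma ucycle_bypass (x y z : G) (q : seq G) : ucycle edge [:: y, x, z & q] ->
  exists2 t, t \in z :: q & edge x t && edge y t.
Proof.
have [n] := ubnP (size q); elim: n => // n IHn in z q *.
case: q => [|z' q] szq ucq.
  have [/= /and4P[_ exz ezy _] _] := andP ucq.
  by exists z; rewrite ?mem_head // exz edge_sym.
have [a [b [e [u [v [def_c euv b0 ae0]]]]]] := chord_split ucq isT.
have shorter r : r != [::] -> ucycle edge [:: y, x & r] ->
    size r < size [:: z, z' & q] -> {subset r <= [:: z, z' & q]} ->
    exists2 t, t \in [:: z, z' & q] & edge x t && edge y t.
  case: r => // w p _ ucr szr sub; case: (IHn w p) => // [|t tp et].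
    exact: leq_trans szr szq.
  by exists t; first exact: sub.
rewrite def_c in ucq; have [uc1 uc2] := ucycle_arcs euv ucq; clear ucq.
have sz_b : 0 < size b by case: b b0 {def_c uc1}.
(* The length of [a] tells whether the chord starts at [y], at [x] or later. In the first case the
   cycle through [b] keeps the edge between [y] and [x]; in the other two the cycle through [a] and
   [e] does. *)
case: a def_c ae0 uc2 => [|a1 [|a2 a]] def_c ae0 uc2.
- have sz_e : 0 < size e by case: e ae0 {def_c uc2}.
  case: b sz_b {b0} def_c uc1 => // b1 b _ [<- <- def_q] uc1.
  apply: (shorter (rcons b v)) => //; rewrite ?def_q.
  + by rewrite -size_eq0 size_rcons.
  + by rewrite size_cat size_rcons /= -addSnnS -[ltnLHS]addn0 ltn_add2l.
  + by move=> t; rewrite -cat_rcons mem_cat => ->.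
- case: def_c uc2 => <- <- def_q uc2.
  apply: (shorter (v :: e)) => //; rewrite def_q.
  + by rewrite size_cat -[ltnLHS]add0n ltn_add2r.
  + by move=> t; rewrite mem_cat => ->; rewrite orbT.
- case: def_c uc2 => <- <- def_q uc2.
  apply: (shorter (a ++ u :: v :: e)) => //; rewrite ?def_q.
  + by rewrite -size_eq0 size_cat /= addnS.
  + by rewrite !size_cat /= size_cat ltn_add2l !ltnS -[ltnLHS]add0n ltn_add2r.
  + move=> t; rewrite !mem_cat !inE mem_cat inE.
    by case/or4P=> ->; rewrite ?orbT.
Qed.

Section Clique.
Variable K : {set G}.
Hypothesis cliqueK : {in K &, forall x y, x != y -> edge x y}.

(** Adjacency in G - K on the unchanged vertex type: vertices of [K] become isolated. *)
Let avoid : rel G := [rel x y | [&& edge x y, x \notin K & y \notin K]].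

Lemma avoid_connect_sym : connect_sym avoid.
Proof.
apply: sym_connect_sym => x y.
by rewrite /avoid /= edge_sym; congr (_ && _); apply: andbC.
Qed.

Lemma avoid_connect_notin x y : connect avoid x y -> (x \in K) = (y \in K).
Proof.
by apply: closed_connect => {x y} x y /and3P[_ /negPf-> /negPf->].
Qed.

Lemma avoid_path_notin x q : x \notin K -> path avoid x q ->
  {in x :: q, forall y, y \notin K}.
Proof.
elim: q x => [|a q IHq] x xK /=; first by move=> _ y; rewrite inE => /eqP->.
case/andP=> /and3P[_ _ aK] /(IHq _ aK) h y; rewrite inE => /predU1P[->//|].
exact: h.
Qed.

(* Take [t] seeing as much of [K] as possible; if it misses [y], then a path inside the component
   from [t] to the first vertex adjacent to [y] ends at a vertex seeing strictly more of [K]. *)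
Lemma component_center c : c \notin K -> exists2 t, connect avoid c t &
  forall u y, connect avoid c u -> y \in K -> edge u y -> edge t y.
Proof.
move=> cK; pose N t := [set x in K | edge t x].
case: (arg_maxnP (fun t => #|N t|) (connect0 avoid c)) => t ct max_t.
exists t => // u y cu yK euy; apply: contraT => nty.
have tK : t \notin K by rewrite -(avoid_connect_notin ct).
have /connectP[p0 pp0 def_u] : connect avoid t u.
  by apply: connect_trans cu; rewrite avoid_connect_sym.
case/shortenP: pp0 def_u => p pp Up _ def_u.
have := @path_first _ avoid (edge^~ y) t p pp; rewrite -def_u => /(_ euy).
case=> q [pq lq nq sq].
have {}Uq : uniq (t :: q) by apply: subseq_uniq Up; rewrite /= eqxx.
have cl : connect avoid c (last t q).
  by apply: connect_trans ct _; apply/connectP; exists q.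
suff: #|N t| < #|N (last t q)| by rewrite ltnNge => /negP[]; apply: max_t.
apply: proper_card; apply/properP; split; last first.
  by exists y; rewrite inE ?yK ?lq // (negPf nty) andbF.
apply/subsetP=> x; rewrite !inE => /andP[xK etx]; rewrite xK /=.
have qK := avoid_path_notin tK pq.
have xy : x != y by apply: contraNneq nty => <-.
(* The clique edge between [x] and [y] closes the path into a cycle. The common neighbour of [x] and
   [y] found on it must be the end of [q], since no earlier vertex sees [y]. *)
have: ucycle edge [:: y, x, t & q].
  apply/andP; split.
    rewrite /= cliqueK // 1?eq_sym // edge_sym etx rcons_path lq andbT.
    by apply: sub_path pq => a b /and3P[].
  rewrite 2!cons_uniq Uq andbT inE eq_sym (negPf xy) /=.
  by rewrite !(contraTN (qK _)) ?yK ?xK.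
case/ucycle_bypass=> z; rewrite lastI mem_rcons inE => /predU1P[->|zq].
  by rewrite edge_sym => /andP[].
case/andP=> _ ; rewrite edge_sym => ezy; case/hasP: nq; by exists z.
Qed.

(** Take one center per component of G - K: centers of distinct components are not adjacent, and a
    vertex of [K] sees the center of the component of any outside neighbour. *)
Lemma dominating_stable :
  {in K, forall x, exists2 y, y \notin K & edge x y} ->
  exists S : {set G}, [/\ S \in Ind G, [disjoint S & K]
    & {in K, forall x, exists2 y, y \in S & edge x y}].
Proof.
move=> outK.
have /fin_all_exists[f fP] c : exists t, c \notin K -> connect avoid c t /\
  forall u y, connect avoid c u -> y \in K -> edge u y -> edge t y.
  (* For [c] in [K] the value is arbitrary; it only makes [f] total. *)
  case: (boolP (c \in K)) => [|cK]; first by exists c.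
  by have [t ct tP] := component_center cK; exists t.
have rootK c : c \notin K -> fingraph.root avoid c \notin K.
  by rewrite (avoid_connect_notin (connect_root avoid c)).
(* Going through [root] makes each component contribute a single center. *)
exists [set f (fingraph.root avoid c) | c in ~: K]; split.
- rewrite inE; apply/forall_inP=> x /imsetP[c]; rewrite inE => cK ->.
  apply/forall_inP=> y /imsetP[c']; rewrite inE => c'K ->.
  have [cc _] := fP _ (rootK _ cK); have [cc' _] := fP _ (rootK _ c'K).
  apply/negP=> eff; have: avoid (f (fingraph.root avoid c)) (f (fingraph.root avoid c')).
    by rewrite /avoid /= eff -(avoid_connect_notin cc) -(avoid_connect_notin cc') !rootK.
  move/connect1=> cff; have : connect avoid (fingraph.root avoid c) (fingraph.root avoid c').
    apply: connect_trans (connect_trans cc cff) _.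
    by rewrite avoid_connect_sym.
  move/(fingraph.rootP avoid_connect_sym); rewrite !root_root; try exact: avoid_connect_sym.
  by move=> rcc; rewrite rcc edge_irrefl in eff.
- apply/pred0P=> y /=; apply/andP=> -[/imsetP[c]]; rewrite inE => cK ->.
  have [cc _] := fP _ (rootK _ cK).
  by rewrite -(avoid_connect_notin cc) (negPf (rootK _ cK)).
- move=> x xK; have [y yK exy] := outK x xK.
  exists (f (fingraph.root avoid y)); first by apply: imset_f; rewrite inE.
  have [_ h] := fP _ (rootK _ yK); rewrite edge_sym; apply: (h y) => //.
    by rewrite avoid_connect_sym connect_root.
  by rewrite edge_sym.
Qed.
End Clique.
End Chordal.

(** * Facets, rank and trailing zeros *)

Section Complex.
Variables (V : finType) (D : {set {set V}}).
Hypothesis D_complex : is_complex D.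

Lemma facet_above F : F \in D -> exists2 F', F' \in facets D & F \subset F'.
Proof.
move=> FD; have [F' maxF' sF] := @maxset_exists _ (mem D) F FD.
by exists F'; rewrite // inE.
Qed.

Lemma facet_face F : F \in facets D -> F \in D.
Proof. by rewrite inE => /maxsetp. Qed.

Lemma facet_max F B : F \in facets D -> B \in D -> F \subset B -> B = F.
Proof. by rewrite inE => /maxsetP[_]; apply. Qed.

Lemma card_face_rank F : F \in D -> #|F| <= rank D.
Proof.
move=> /facet_above[F' facF' /subset_leq_card sF].
by apply: leq_trans sF _; apply: leq_bigmax_cond.
Qed.

Lemma rank_facet : exists2 F, F \in facets D & #|F| = rank D.
Proof.
have [F0 facF0 _] := facet_above D_complex.1.
have [|F facF rF] := @eq_bigmax_cond _ (mem (facets D)) (fun F => #|F|).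
  by apply/card_gt0P; exists F0.
by exists F.
Qed.

Lemma faces_of_size_rank : faces_of_size D (rank D) != 0.
Proof.
have [F facF szF] := rank_facet.
by rewrite -lt0n; apply/card_gt0P; exists F; rewrite inE facet_face //= szF.
Qed.

Lemma faces_of_size_gt_rank k : rank D < k -> faces_of_size D k = 0.
Proof.
move=> rk; apply/eqP; rewrite cards_eq0; apply/eqP/setP=> F; rewrite !inE.
apply/negP=> /andP[/card_face_rank rF /eqP szF].
by rewrite szF leqNgt rk in rF.
Qed.

(** The entry at [rank D] is nonzero and all later ones vanish, so trimming stops exactly there. *)
Lemma trim_mkseq_faces d : rank D <= d ->
  trim_zeros (mkseq (fun k => (faces_of_size D k)%:Z%R) d.+1) = fvector D.
Proof.
move=> rd; rewrite /trim_zeros /fvector.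
set g := fun k => _.
suff -> : Poly (mkseq g d.+1) = Poly (mkseq g (rank D).+1).
  apply: (@PolyK _ 0%R); rewrite -nth_last size_mkseq nth_mkseq //.
  by rewrite /g eqz_nat faces_of_size_rank.
apply/polyP=> k; rewrite !coef_Poly.
have [kr|rk] := leqP k (rank D).
  by rewrite !nth_mkseq // (leq_ltn_trans (leq_trans kr rd)).
rewrite [RHS]nth_default ?size_mkseq //.
have [kd|dk] := leqP k d; last by rewrite nth_default ?size_mkseq.
by rewrite nth_mkseq // /g faces_of_size_gt_rank.
Qed.

End Complex.

(** * Independence complexes of induced subgraphs *)

Lemma IndP (G : sgraph) (F : {set G}) :
  reflect {in F &, forall x y, ~~ edge x y} (F \in Ind G).
Proof.
rewrite inE; apply: (iffP forall_inP) => [indF x y xF yF|indF x xF].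
  by have /forall_inP := indF x xF; apply.
by apply/forall_inP=> y yF; apply: indF.
Qed.

Section Embedding.
Variables (H G : sgraph) (f : H -> G).
Hypotheses (f_inj : injective f) (f_edge : forall x y, edge (f x) (f y) = edge x y).

Lemma chordal_induced : chordal G -> chordal H.
Proof.
move=> chG c /andP[cyc Uc] szc.
have [||_ [_ [/mapP[x xc ->] /mapP[y yc ->]]]] := chG (map f c).
- rewrite /ucycle map_inj_uniq // Uc andbT cycle_map.
  by rewrite (eq_cycle (e' := edge)) // => x y /=; rewrite f_edge.
- by rewrite size_map.
rewrite f_edge !next_map // => exy; rewrite !(inj_eq f_inj) => nyx nxy.
by exists x, y.
Qed.

Lemma Ind_imset (F : {set H}) : (f @: F \in Ind G) = (F \in Ind H).
Proof.
apply/IndP/IndP=> indF.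
  by move=> x y xF yF; rewrite -f_edge indF ?imset_f.
by move=> _ _ /imsetP[x xF ->] /imsetP[y yF ->]; rewrite f_edge indF.
Qed.

Lemma faces_of_size_induced k : faces_of_size (Ind H) k =
  #|[set F in Ind G | (F \subset codom f) && (#|F| == k)]|.
Proof.
rewrite /faces_of_size -[LHS](card_imset _ (imset_inj f_inj)); congr #|pred_of_set _|.
apply/setP=> F; apply/imsetP/idP.
  case=> W; rewrite inE => /andP[WH szW] ->; rewrite inE Ind_imset WH.
  rewrite card_imset // szW andbT; apply/subsetP=> _ /imsetP[x _ ->].
  exact: codom_f.
rewrite inE => /and3P[FG /subsetP Ff szF].
have def_F : F = f @: (f @^-1: F).
  apply/setP=> y; apply/idP/imsetP=> [yF|[x]]; last by rewrite inE => xF ->.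
  by have /codomP[x def_y] := Ff y yF; exists x; rewrite // inE -def_y.
exists (f @^-1: F) => //; rewrite inE -Ind_imset -def_F FG /=.
by rewrite -(card_imset _ f_inj) -def_F.
Qed.

End Embedding.

(** * Clique-whiskerings: the colour classes are the cliques, the [w j] the whiskers *)

Section CliqueWhiskering.
Variables (G : sgraph) (d : nat) (col : G -> 'I_d) (w : 'I_d -> G).
Hypothesis wK : cancel w col.
Hypothesis edge_col : forall x y, x != y -> col x = col y -> edge x y.
Hypothesis nbhd_w : forall j x, edge (w j) x -> col x = j.

Let w_inj : injective w := can_inj wK.

Lemma Ind_col_inj F : F \in Ind G -> {in F &, injective col}.
Proof.
move=> /IndP indF x y xF yF cxy; apply/eqP; apply: contraT => xy.
by have /negP[] := indF x y xF yF; apply: edge_col.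
Qed.

Lemma card_Ind F : F \in Ind G -> #|F| <= d.
Proof.
by move=> /Ind_col_inj/card_in_imset <-; rewrite -[d in _ <= d]card_ord max_card.
Qed.

(** A whisker has neighbours only of its own colour, and the colours in [U] do not occur in [F]. *)
Lemma Ind_add_whiskers F (U : {set 'I_d}) :
  F \in Ind G -> [disjoint U & col @: F] -> F :|: w @: U \in Ind G.
Proof.
move=> /IndP indF UF; have FU x j : x \in F -> j \in U -> ~~ edge (w j) x.
  move=> xF jU; apply/negP=> /nbhd_w cx; have /pred0P/(_ j) /= := UF.
  by rewrite jU -cx imset_f.
apply/IndP=> x y /setUP[xF|/imsetP[i iU ->]] /setUP[yF|/imsetP[j jU ->]].
- exact: indF.
- by rewrite edge_sym FU.
- exact: FU.
- apply/negP=> eij; have := nbhd_w eij; rewrite wK => ij.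
  by rewrite ij edge_irrefl in eij.
Qed.

(** When [A] has no whiskers and its colours lie in [J], deletion and link of a vertex of [A] give
    families of the same kind, so that induction is possible. *)
Definition whiskered_subcomplex (A : {set G}) (J : {set 'I_d}) :=
  [set F in Ind G | F \subset A :|: w @: J].

Lemma in_whiskered (A : {set G}) (J : {set 'I_d}) (F : {set G}) : (F \in whiskered_subcomplex A J) =
  (F \in Ind G) && (F \subset A :|: w @: J).
Proof. exact: in_set. Qed.

Lemma whiskered_subcomplex_complex A J :
  is_complex (whiskered_subcomplex A J).
Proof.
have [Ind0 IndS] := Ind_complex G; split; first by rewrite in_whiskered Ind0 sub0set.
move=> B C sBC; rewrite !in_whiskered => /andP[CG CA].
by rewrite (IndS B C) ?(subset_trans sBC).
Qed.

(** A facet has every colour of [J], since the whisker of a missing colour could be added, and has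
    it once because colour classes are cliques. *)
Lemma whiskered_facet (A : {set G}) (J : {set 'I_d}) F : {in A, forall x, col x \in J} ->
  F \in facets (whiskered_subcomplex A J) -> #|F| = #|J|.
Proof.
move=> AJ facF; have := facet_face facF; rewrite in_whiskered => /andP[FG FA].
have colF : col @: F \subset J.
  apply/subsetP=> _ /imsetP[x xF ->].
  have /setUP[/AJ//|/imsetP[j jJ ->]] := subsetP FA x xF.
  by rewrite wK.
have FJ : F :|: w @: (J :\: col @: F) \in Ind G.
  by apply: Ind_add_whiskers; rewrite // disjoint_sym disjoints_subset setCD subsetUr.
have def_F : F :|: w @: (J :\: col @: F) = F.
  apply: (facet_max facF); rewrite ?subsetUl // in_whiskered FJ subUset FA /=.
  by rewrite (subset_trans (imsetS _ (subsetDl _ _))) // subsetUr.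
rewrite -{1}def_F -(card_in_imset (Ind_col_inj FJ)) imsetU -imset_comp.
rewrite (eq_imset (g := id)) => [|j /=]; last by rewrite wK.
by rewrite imset_id -{1}(setIidPr colF) setID.
Qed.

Lemma whiskered_pure (A : {set G}) (J : {set 'I_d}) : {in A, forall x, col x \in J} ->
  pure (whiskered_subcomplex A J).
Proof. by move=> AJ F1 F2 /whiskered_facet-> // /whiskered_facet->. Qed.

(** Induction on the size of [A], shedding any vertex of [A]; once [A] is empty, [w @: J] is the
    only facet. *)
Lemma whiskered_vertex_decomposable (A : {set G}) (J : {set 'I_d}) :
  {in A, forall x, x \notin codom w} -> {in A, forall x, col x \in J} ->
  vertex_decomposable (whiskered_subcomplex A J).
Proof.
have [n] := ubnP #|A|; elim: n => // n IHn in A J *; rewrite ltnS => szA Aw AJ.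
have pureAJ := whiskered_pure AJ.
have cAJ := whiskered_subcomplex_complex A J.
have [A0|[v vA]] := set_0Vmem A.
  apply: VD_simplex => //; apply/eqP/cards1P; exists (w @: J); apply/eqP.
  rewrite eqEsubset; apply/andP; split.
    apply/subsetP=> F facF; rewrite inE eqEcard (whiskered_facet AJ facF) //.
    rewrite card_imset // leqnn andbT.
    by have := facet_face facF; rewrite A0 in_whiskered set0U => /andP[].
  rewrite sub1set; have [F facF _] := facet_above cAJ.1.
  suff -> : w @: J = F by [].
  apply/esym/eqP; rewrite eqEcard (whiskered_facet AJ facF) // card_imset // leqnn andbT.
  by have := facet_face facF; rewrite A0 in_whiskered set0U => /andP[].
have v_whisker j : v != w j by apply: contraNneq (Aw v vA) => ->; apply: codom_f.
have szAv : #|A :\ v| < n by rewrite (cardsD1 v) vA in szA.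
apply: (@VD_vertex _ _ v) => //.
- rewrite in_whiskered sub1set in_setU vA andbT; apply/IndP=> x y /set1P-> /set1P->.
  by rewrite edge_irrefl.
- rewrite (_ : deletion _ v = whiskered_subcomplex (A :\ v) J).
    apply: IHn => // x /setD1P[_]; [exact: Aw | exact: AJ].
  apply/setP=> F; rewrite in_set !in_whiskered -!andbA; congr (_ && _).
  apply/andP/subsetP => [[/subsetP FA vF] x xF|FA].
    have := FA x xF; rewrite !inE => /orP[->|->]; last by rewrite orbT.
    by rewrite (contraNneq _ vF) // => <-.
  split; first by apply/subsetP=> x /FA; rewrite !inE => /orP[/andP[_ ->]|->] //; rewrite orbT.
  apply/negP=> /FA; rewrite !inE eqxx /= => /imsetP[j _ vj].
  by have := v_whisker j; rewrite vj eqxx.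
(* Passing to the link removes the neighbours of [v], among them the rest of its colour class with
   the whisker, so the colour of [v] leaves [J]. *)
- pose A' := [set x in A :\ v | ~~ edge v x].
  rewrite (_ : link _ v = whiskered_subcomplex A' (J :\ col v)); last first.
  apply/setP=> F; rewrite in_set !in_whiskered -!andbA.
  have [FG|//] := boolP (F \in Ind G); rewrite /= subUset sub1set in_setU vA /=.
  apply/and4P/subsetP => [[/subsetP FA vF /IndP indF _] x xF|FA].
    have xv : x != v by apply: contraNneq vF => <-.
    have nvx : ~~ edge v x by rewrite indF ?setU11 ?setU1r.
    have := FA x xF; rewrite !inE xv nvx andbT /= => /orP[->//|/imsetP[j jJ xj]].
    apply/orP; right; rewrite xj imset_f // !inE jJ andbT.
    by apply: contraNneq nvx => cj; apply: edge_col; rewrite 1?eq_sym // xj wK.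
  have FA' : F \subset A :|: w @: J.
    apply/subsetP=> x /FA; rewrite !inE => /orP[/andP[/andP[_ ->]]//|].
    by case/imsetP=> j /setD1P[_ jJ] ->; rewrite imset_f ?orbT.
  split=> //.
    apply/negP=> /FA; rewrite !inE eqxx /= => /imsetP[j _ vj].
    by have := v_whisker j; rewrite vj eqxx.
  (* The remaining whiskers have colours other than that of [v], so none is adjacent to [v]. *)
  have vF x : x \in F -> ~~ edge v x.
    move=> /FA; rewrite !inE => /orP[/andP[]//|/imsetP[j /setD1P[jv _] ->]].
    by apply: contraNN jv; rewrite edge_sym => /nbhd_w ->.
  apply/IndP=> x y /setU1P[->|xF] /setU1P[->|yF].
  + by rewrite edge_irrefl.
  + exact: vF.
  + by rewrite edge_sym vF.
  + by move/IndP: FG; apply.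
  apply: IHn.
  + by apply: leq_ltn_trans szAv; apply/subset_leq_card/subsetP=> x; rewrite inE => /andP[].
  + by move=> x; rewrite !inE => /andP[/andP[_ /Aw]].
  + move=> x; rewrite !inE => /andP[/andP[xv xA] nvx]; rewrite AJ // andbT.
    by apply: contraNneq nvx => cxv; apply: edge_col; rewrite // eq_sym.
Qed.

Lemma whiskered_full : whiskered_subcomplex (~: [set x in codom w]) setT = Ind G.
Proof.
apply/setP=> F; rewrite in_whiskered; have [//|//] := boolP (F \in Ind G).
move=> _; apply/subsetP=> x _; rewrite !inE.
have [/codomP[j ->]|//] := boolP (x \in codom w).
by rewrite imset_f ?inE.
Qed.

Lemma whiskering_vertex_decomposable : vertex_decomposable (Ind G).
Proof.
rewrite -whiskered_full; apply: whiskered_vertex_decomposable => x; by rewrite !inE.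
Qed.

Lemma whiskering_rank : rank (Ind G) = d.
Proof.
have [F facF <-] := rank_facet (Ind_complex G).
rewrite -whiskered_full in facF.
by rewrite (whiskered_facet _ facF) ?cardsT ?card_ord // => x _; apply: in_setT.
Qed.

Lemma whiskering_balanced : balanced (Ind G).
Proof.
rewrite /balanced whiskering_rank; exists col => F /facet_face indF j.
apply/card_le1_eqP=> x y; rewrite !inE => /andP[xF /eqP cx] /andP[yF /eqP cy].
by apply: (Ind_col_inj indF) => //; rewrite cx cy.
Qed.

(** The f-vector of [G] without its whiskers, counted inside [G]. *)
Let base k := #|[set W in Ind G | (W \subset ~: [set x in codom w]) && (#|W| == k)]|.

(** [F] is determined by the colours of its whiskers, which can be any [i - #|W|] of the [d - #|W|]
    colours missing from [W]. *)
Lemma whiskered_fiber i W : W \in Ind G -> W \subset ~: [set x in codom w] -> #|W| <= i ->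
  #|[set F in Ind G | (#|F| == i) && (F :\: [set x in codom w] == W)]|
    = 'C(d - #|W|, i - #|W|).
Proof.
move=> WG Ww Wi.
have ww j : (w j \in W) = false.
  by apply/negP=> /(subsetP Ww); rewrite !inE codom_f.
have wWU (U : {set 'I_d}) : w @^-1: (W :|: w @: U) = U.
  by apply/setP=> j; rewrite !inE ww mem_imset.
have dWU (U : {set 'I_d}) : [disjoint W & w @: U].
  rewrite disjoint_sym; apply/pred0P=> x /=; apply/andP=> -[/imsetP[j _ ->]].
  by rewrite ww.
have cW : #|~: (col @: W)| = d - #|W|.
  by rewrite cardsCs setCK card_ord card_in_imset //; apply: Ind_col_inj.
rewrite -cW -cards_draws.
rewrite -(card_in_imset (f := fun U : {set 'I_d} => W :|: w @: U)) => [|U1 U2 _ _ eqU]; last first.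
  by rewrite -[U1]wWU eqU wWU.
have cWU (U : {set 'I_d}) : #|W :|: w @: U| = #|W| + #|U|.
  by rewrite cardsU disjoint_setI0 // cards0 subn0 card_imset.
congr #|pred_of_set _|; apply/setP=> F; rewrite in_set; apply/idP/imsetP.
  case/and3P=> FG /eqP szF /eqP defW; pose U := w @^-1: F.
  have defF : F = W :|: w @: U.
    apply/setP=> x; rewrite -defW !inE.
    have [/codomP[j ->]|xw] := boolP (x \in codom w); first by rewrite mem_imset // inE.
    rewrite /=; case: (x \in F) => //=; apply/esym/negP=> /imsetP[j _ xj].
    by rewrite xj codom_f in xw.
  exists U => //; rewrite inE -(eqn_add2l #|W|) -cWU -defF szF subnKC // eqxx andbT.
  apply/subsetP=> j; rewrite !inE => wjF; apply/imsetP=> -[x xW jx].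
  have xF : x \in F by rewrite defF inE xW.
  have wjx : w j = x by apply: (Ind_col_inj FG) => //; rewrite wK.
  by rewrite -wjx ww in xW.
case=> U; rewrite inE => /andP[UW /eqP szU] ->.
rewrite Ind_add_whiskers ?disjoints_subset // cWU szU subnKC // eqxx /=.
apply/eqP/setP=> x; rewrite !inE.
have [/codomP[j ->]|xw] := boolP (x \in codom w); first by rewrite ww.
by rewrite orb_idr //= => /imsetP[j _ xj]; rewrite xj codom_f in xw.
Qed.

(** Group the faces by their part outside the whiskers, then these parts by size. *)
Lemma whiskering_faces_of_size i :
  faces_of_size (Ind G) i = \sum_(j < i.+1) base j * 'C(d - j, i - j).
Proof.
pose P W := [&& W \in Ind G, W \subset ~: [set x in codom w] & #|W| <= i].
rewrite /faces_of_size -sum1_card.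
rewrite (partition_big (fun F => F :\: [set x in codom w]) P) /=; last first.
  move=> F; rewrite in_set => /andP[FG /eqP Fi]; rewrite /P -Fi subset_leq_card ?subsetDl // andbT.
  have [_ IndS] := Ind_complex G.
  by rewrite (IndS _ F (subsetDl _ _)) // setDE subsetIr.
transitivity (\sum_(W | P W) 'C(d - #|W|, i - #|W|)).
  apply: eq_bigr => W /and3P[WG Ww Wi]; rewrite -whiskered_fiber // -sum1_card.
  by apply: eq_bigl => F; rewrite !in_set andbA.
(* [P] bounds the size by [i], so [inord] never takes its default value. *)
rewrite (partition_big (fun W : {set G} => inord #|W| : 'I_i.+1) predT) //=.
apply: eq_bigr => j _; rewrite /base -sum1_card big_distrl /=.
have ltj := ltn_ord j.
apply: eq_big => [W|W /andP[/and3P[_ _ Wi] /eqP<-]]; last first.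
  by rewrite inordK // mul1n.
rewrite in_set /P -!andbA; congr [&& _, _ & _].
apply/andP/eqP => [[Wi /eqP<-]|Wj]; first by rewrite inordK.
by rewrite Wj -ltnS ltj; split=> //; apply/eqP/val_inj; rewrite /= inordK.
Qed.

Variables (H : sgraph) (f : H -> G).
Hypotheses (f_inj : injective f) (f_edge : forall x y, edge (f x) (f y) = edge x y).
Hypothesis f_codom : forall x, (x \in codom f) = (x \notin codom w).

(** [base] counts the faces of [Ind H], and [binomial_inversion] recovers it from those of [Ind G].
    An abstract [f] lets [H] be a summand or a subtype. *)
Lemma whiskering_hvector : trim_zeros (hvector (Ind G)) = fvector (Ind H).
Proof.
have baseE k : base k = faces_of_size (Ind H) k.
  rewrite (faces_of_size_induced f_inj f_edge) /base; congr #|pred_of_set _|.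
  apply/setP=> W; rewrite !in_set; congr [&& _, _ & _].
  by apply/subsetP/subsetP=> Ww x /Ww; rewrite !inE f_codom.
rewrite -(@trim_mkseq_faces _ _ (Ind_complex H) d).
  congr trim_zeros; rewrite /hvector whiskering_rank.
  apply/eq_in_map=> k; rewrite mem_iota add0n ltnS /= => kd.
  rewrite (binomial_inversion (a := base)) ?baseE // => i _.
  exact: whiskering_faces_of_size.
(* The rank of [Ind H] may be below [d]; it is at most [d] because images of its faces are faces of
   [Ind G]. *)
have [F facF <-] := rank_facet (Ind_complex H).
rewrite -(card_imset _ f_inj); apply: card_Ind.
by rewrite (Ind_imset f_edge) facet_face.
Qed.

End CliqueWhiskering.

(** * Attaching pendant vertices: from f-vectors to h-vectors *)

Section Whisker.
Variable G : sgraph.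

Definition whisker_edge : rel (G + G) := fun u v =>
  match u, v with
  | inl x, inl y => edge x y
  | inl x, inr y | inr x, inl y => x == y
  | inr _, inr _ => false
  end.

Lemma whisker_sym : symmetric whisker_edge.
Proof.
case=> x [] y /=; [exact: edge_sym | exact: eq_sym | exact: eq_sym | by []].
Qed.

Lemma whisker_irrefl : irreflexive whisker_edge.
Proof. by case=> x //=; rewrite edge_irrefl. Qed.

Definition whisker : sgraph := SGraph whisker_sym whisker_irrefl.

(* A pendant vertex lies on no cycle: both of its neighbours there would be the same vertex. *)
Lemma whisker_pendant (c : seq whisker) x :
  ucycle edge c -> 2 < size c -> inr x \notin c.
Proof.
move=> ucc szc; apply/negP=> /mem_split[a [b def_c]].
have {szc} : 2 < size ((inr x :: b) ++ a) by rewrite size_cat addnC -size_cat -def_c.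
move: ucc; rewrite def_c -(rot_ucycle (size a)) rot_size_cat /=.
case: (b ++ a) => [|y p] //=; case/lastP: p => [|p z] //= /andP[/= /andP[xy]].
rewrite rcons_path last_rcons => /andP[_ zx] /and3P[_ yp _] _.
move: xy zx yp; case: y => // y; case: z => // z; rewrite /edge /= => /eqP<- /eqP->.
by rewrite mem_rcons mem_head.
Qed.

(** The cycle avoids the pendant vertices, so it is the image of a cycle of [G], whose chord carries
    over. *)
Lemma whisker_chordal : chordal G -> chordal whisker.
Proof.
move=> chG c ucc szc.
have inl_c : {in c, forall u, exists x : G, u = inl x}.
  case=> x xc; first by exists x.
  by have /negP[] := whisker_pendant x ucc (ltnW szc).
have [c' def_c] : exists c', c = map (inl : G -> whisker) c'.
  elim: c inl_c {ucc szc} => [|u c IHc] inl_c; first by exists [::].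
  have [x ->] := inl_c u (mem_head u c).
  have [|c' ->] := IHc; first by move=> v vc; apply: inl_c; rewrite inE vc orbT.
  by exists (x :: c').
have inl_inj : injective (inl : G -> whisker) by move=> x y [].
have [/= cyc Uc] := andP ucc; rewrite def_c in cyc Uc szc *.
rewrite (map_inj_uniq inl_inj) in Uc.
have [||x [y [xc yc exy nyx nxy]]] := chG c'.
- by rewrite /ucycle Uc andbT; move: cyc; rewrite cycle_map.
- by rewrite size_map in szc.
by exists (inl x), (inl y); rewrite !(mem_map inl_inj) !next_map.
Qed.

(** The cliques are the pendant edges and the whiskers their [inr] ends; removing these leaves a
    copy of [G]. *)
Lemma whisker_realizes_fvector :
  [/\ balanced (Ind whisker), vertex_decomposable (Ind whisker)
    & trim_zeros (hvector (Ind whisker)) = fvector (Ind G)].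
Proof.
pose col (u : whisker) : 'I_#|G| := enum_rank (match u with inl x => x | inr x => x end).
pose w (j : 'I_#|G|) : whisker := inr (enum_val j).
have wK : cancel w col by move=> j; apply: enum_valK.
have edge_col x y : x != y -> col x = col y -> edge x y.
  move=> xy /enum_rank_inj; case: x y xy => x [] y xy exy.
  - by rewrite exy eqxx in xy.
  - exact/eqP.
  - exact/eqP.
  - by rewrite exy eqxx in xy.
have nbhd_w j x : edge (w j) x -> col x = j.
  by case: x => x //; rewrite /edge /= /col => /eqP<-; rewrite enum_valK.
split.
- exact: whiskering_balanced wK edge_col nbhd_w.
- exact: whiskering_vertex_decomposable wK edge_col nbhd_w.
- apply: (whiskering_hvector wK edge_col nbhd_w (f := inl)) => //.
    by move=> x y [].
  case=> x; first by rewrite codom_f; apply/esym/codomP=> -[].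
  have -> : (inr x : whisker) \in codom w
    by apply/codomP; exists (enum_rank x); rewrite /w enum_rankK.
  by apply/negP=> /codomP[].
Qed.

End Whisker.

(** * Balanced pure complexes: from h-vectors to f-vectors *)

(** Otherwise a facet containing the set from [dominating_stable] would miss [K]. *)
Lemma clique_meeting_facets_simplicial (G : sgraph) (K : {set G}) : chordal G ->
  {in K &, forall x y, x != y -> edge x y} ->
  (forall F, F \in facets (Ind G) -> F :&: K != set0) ->
  exists2 x, x \in K & forall y, edge x y -> y \in K.
Proof.
move=> chG cliqueK meetK.
have [/exists_inP[x xK /forall_inP xN]|noK] :=
  boolP [exists x in K, forall (y | edge x y), y \in K].
  by exists x.
have [x xK|S [SG SK domS]] := dominating_stable chG cliqueK.
  move: noK; rewrite negb_exists_in => /forall_inP/(_ x xK).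
  rewrite negb_forall_in => /exists_inP[y exy yK].
  by exists y.
have [F facF /subsetP SF] := facet_above SG.
have /set0Pn[x /setIP[xF xK]] := meetK F facF.
have [y yS exy] := domS x xK.
by have /IndP/(_ x y xF (SF y yS)) := facet_face facF; rewrite exy.
Qed.

Lemma balanced_pure_whiskering (G : sgraph) :
  chordal G -> balanced (Ind G) -> pure (Ind G) ->
  exists H : sgraph, chordal H /\ trim_zeros (hvector (Ind G)) = fvector (Ind H).
Proof.
move=> chG [col colP] pureG.
have edge_col x y : x != y -> col x = col y -> edge x y.
  move=> xy cxy; apply: contraT => nxy.
  (* Nonadjacent vertices share a facet, which holds at most one vertex of each colour. *)
  have [|F facF /subsetP sF] := @facet_above _ (Ind G) [set x; y].
    apply/IndP=> u v /set2P[]-> /set2P[]->; rewrite ?edge_irrefl //.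
    by rewrite edge_sym.
  have /card_le1_eqP/(_ x y) := colP F facF (col x).
  rewrite !inE cxy eqxx !sF ?set21 ?set22 // => /(_ isT isT) exy.
  by rewrite exy eqxx in xy.
(* By purity every facet has as many vertices as there are colours, so no colour is missed. *)
have meet j F : F \in facets (Ind G) -> F :&: [set x | col x == j] != set0.
  move=> facF; apply/eqP=> Fj.
  have [F0 facF0 szF0] := rank_facet (Ind_complex G).
  have : #|col @: F| = rank (Ind G).
    transitivity #|F|; last by rewrite (pureG _ _ facF facF0).
    apply: card_in_imset => x y xF yF cxy.
    have /card_le1_eqP/(_ x y) := colP F facF (col x).
    by rewrite !inE cxy eqxx xF yF => /(_ isT isT).
  have: col @: F \subset [set~ j].
    apply/subsetP=> _ /imsetP[x xF ->]; rewrite !inE; apply/eqP=> cx.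
    by have /setP/(_ x) := Fj; rewrite !inE xF cx eqxx.
  move/subset_leq_card; rewrite cardsC1 card_ord => szF def_sz.
  (* The colour [j] itself shows that the rank is positive, so its predecessor is a genuine one. *)
  have r_gt0 := leq_ltn_trans (leq0n j) (ltn_ord j).
  by rewrite def_sz -ltnS prednK // ltnn in szF.
have /fin_all_exists[w wP] j : exists x, col x = j /\ forall y, edge x y -> col y = j.
  have [x y||x] := @clique_meeting_facets_simplicial G [set x | col x == j] chG.
  - by rewrite !inE => /eqP xj /eqP yj xy; apply: edge_col => //; rewrite xj yj.
  - exact: meet.
  rewrite inE => /eqP xj xN; exists x; split=> // y /xN.
  by rewrite inE => /eqP.
have wK : cancel w col by move=> j; case: (wP j).
have nbhd_w j x : edge (w j) x -> col x = j by case: (wP j) => _; apply.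
pose T := {x : G | x \notin codom w}.
pose e : rel T := fun x y => edge (val x) (val y).
have e_sym : symmetric e by move=> x y; apply: edge_sym.
have e_irr : irreflexive e by move=> x; apply: edge_irrefl.
pose H := SGraph e_sym e_irr; pose f : H -> G := val.
have f_inj : injective f by apply: val_inj.
exists H; split; first exact: (chordal_induced f_inj).
apply: (whiskering_hvector wK edge_col nbhd_w f_inj) => //.
move=> x; apply/codomP/idP => [[y ->]|xw]; first exact: (valP y).
by exists (exist _ x xw).
Qed.

Theorem theorem5p9 (s : seq int) :
  (exists G : sgraph, chordal G /\ s = fvector (Ind G)) <->
  (exists G : sgraph,
     [/\ chordal G, balanced (Ind G), vertex_decomposable (Ind G)
       & s = trim_zeros (hvector (Ind G))]).
Proof.
split=> [[G [chG ->]]|[G [chG balG vdG ->]]].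
  have [bal vd hE] := whisker_realizes_fvector G.
  by exists (whisker G); split=> //; apply: whisker_chordal.
have pureG : pure (Ind G) by case: vdG.
have [H [chH ->]] := balanced_pure_whiskering chG balG pureG.
by exists H.
Qed.
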